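(* Let $\varphi=\varphi_p$ or $\varphi=\varphi_{p,q}$, let $h$ be a continuous proper exhaustion of $A$, and let $h'$ be any continuous proper exhaustion of $A$ with $h'\sim h$. Then the constants $C^{(h)}_\varphi(f;L)$ and $C^{(h')}_\varphi(f;L)$ are comparable, i.e. there is $C\ge1$, depending only on $p,q$ and the coarse-affine data (the constants $a_1,a_2,b_1,b_2$ in $h'\sim h$), with $$C^{-1}C^{(h)}_\varphi(f;L)\le C^{(h')}_\varphi(f;L)\le C\,C^{(h)}_\varphi(f;L)\qquad\text{for all }f\in C(A),\ L\in\mathbb{R}.$$ In particular the decay class $O(h^{-p})$ depends only on the coarse-affine class of $h$, for every $A$; that is, if $h'\sim h$ then for all $f\in C(A)$ and $L\in\mathbb{R}$ one has $f-L=O(h^{-p})$ at infinity if and only if $f-L=O(h'^{-p})$ at infinity.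
   Context: $A$ is a non-compact, locally compact, $\sigma$-compact Hausdorff space. A continuous proper exhaustion is a continuous $h:A\to[0,\infty)$ such that $h^{-1}([0,R])$ is compact for every $R<\infty$. $C(A)$ is the space of real continuous functions on $A$. Two functions $h,h':A\to[0,\infty)$ are coarsely affinely equivalent, written $h\sim h'$, if there are $a_1,a_2>0$ and $b_1,b_2\ge0$ with $a_1h-b_1\le h'\le a_2h+b_2$ on $A$. The weights are $\varphi_p(t)=(1+t)^p$ with $p>0$, and $\varphi_{p,q}(t)=(1+t)^p(1+\log(1+t))^q$ with $p>0$ and $q\in\mathbb{R}$ such that $\varphi_{p,q}$ is admissible. Admissible means: $\varphi:[0,\infty)\to[1,\infty)$ is continuous, non-decreasing, $\varphi(0)=1$, and there is $K\ge1$ with $\varphi(r+s)\le K\varphi(r)\varphi(s)$ for all $r,s\ge0$. $C^{(h)}_\varphi(f;L):=\limsup_{h(a)\to\infty}\varphi(h(a))|f(a)-L|=\lim_{R\to\infty}\sup_{\{h>R\}}\varphi(h)|f-L|\in[0,\infty]$. $f-L=O(h^{-p})$ at infinity means there are $M,R<\infty$ with $|f(a)-L|\le M\,h(a)^{-p}$ whenever $h(a)>R$. *)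

(* Defs.v *)
From HB Require Import structures.
From mathcomp Require Import all_boot all_order all_algebra.
From mathcomp Require Import all_classical all_reals all_analysis.

Set Implicit Arguments.
Unset Strict Implicit.
Unset Printing Implicit Defensive.

Import Order.TTheory GRing.Theory Num.Theory.
Import numFieldNormedType.Exports.

Local Open Scope classical_set_scope.
Local Open Scope ring_scope.

Definition sigma_compact (A : topologicalType) : Prop :=
  exists K : nat -> set A,
    (forall n, compact (K n)) /\ \bigcup_n K n = [set: A].

Definition continuous_proper_exhaustion (R : realType) (A : topologicalType)
    (h : A -> R) : Prop :=
  [/\ continuous h, forall a, 0 <= h a
    & forall r : R, compact (h @^-1` `[0, r])].

Definition coarse_affine_bounds (R : realType) (A : Type) (a1 a2 b1 b2 : R)
    (h h' : A -> R) : Prop :=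
  forall a, a1 * h a - b1 <= h' a <= a2 * h a + b2.

Definition coarsely_affinely_equivalent (R : realType) (A : Type)
    (h h' : A -> R) : Prop :=
  exists a1 a2 b1 b2 : R,
    [/\ 0 < a1, 0 < a2, 0 <= b1, 0 <= b2
      & coarse_affine_bounds a1 a2 b1 b2 h h'].

Definition weight_p (R : realType) (p : R) : R -> R :=
  fun t => (1 + t) `^ p.

Definition weight_pq (R : realType) (p q : R) : R -> R :=
  fun t => (1 + t) `^ p * (1 + ln (1 + t)) `^ q.

(* Weights are functions on R of which only the values on [0, +oo[ matter. *)
Definition admissible (R : realType) (phi : R -> R) : Prop :=
  [/\ {within `[0, +oo[, continuous phi},
      forall s t, 0 <= s -> s <= t -> phi s <= phi t,
      phi 0 = 1,
      forall t, 0 <= t -> 1 <= phi t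
    & exists2 K : R, 1 <= K &
        forall r s, 0 <= r -> 0 <= s -> phi (r + s) <= K * phi r * phi s].

Definition is_weight (R : realType) (p q : R) (phi : R -> R) : Prop :=
  phi = weight_p p \/ (phi = weight_pq p q /\ admissible phi).

(* When h is a proper exhaustion of a non-compact space, {h > r} is never
   empty, so that this supremum is never -oo. *)
Definition tail_sup (R : realType) (A : Type) (phi : R -> R) (h f : A -> R)
    (L r : R) : \bar R :=
  ereal_sup [set (phi (h a) * `|f a - L|)%:E | a in [set a | r < h a]].

Definition decay_constant (R : realType) (A : Type) (phi : R -> R)
    (h f : A -> R) (L : R) : \bar R :=
  lim (tail_sup phi h f L r @[r --> +oo]).

(* The witness r may always be enlarged to be nonnegative, so the convention
   0 `^ (- p) = 0 at the zeros of h is harmless. *)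
Definition bigO_at_infinity (R : realType) (A : Type) (p : R) (h f : A -> R)
    (L : R) : Prop :=
  exists M r : R, forall a, r < h a -> `|f a - L| <= M * h a `^ (- p).

(* Main.v *)
(* All estimates rest on a single one-sided bound h <= a h' + b. It puts a far
   tail {h > a r + b} inside {h' > r}, and it gives phi(h) <= C phi(h') with C
   independent of the space, because the weights are nondecreasing and change by
   at most a constant factor when 1 + t is multiplied by a constant. Since the
   decay constant is the infimum of the tail suprema, it obeys the same bound;
   inverting a1 h' - b1 <= h gives the reverse comparison. *)
Require Import Defs.
From HB Require Import structures.
From mathcomp Require Import all_boot all_order all_algebra.
From mathcomp Require Import all_classical all_reals all_analysis.
From mathcomp Require Import lra.

Set Implicit Arguments.
Unset Strict Implicit.
Unset Printing Implicit Defensive.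

Import Order.TTheory GRing.Theory Num.Theory.
Import numFieldNormedType.Exports.

Local Open Scope classical_set_scope.
Local Open Scope ring_scope.

Lemma powR_ge1 (R : realType) (x r : R) : 1 <= x -> 0 <= r -> 1 <= x `^ r.
Proof. by move=> x1 r0; rewrite -(powRr0 x) ler_powR. Qed.

(* The exponent q may be negative, in which case the factor at c only helps. *)
Lemma powR_1Dln_le (R : realType) (q c x : R) : 1 <= c -> 1 <= x ->
  (1 + ln (c * x)) `^ q <= (1 + ln c) `^ `|q| * (1 + ln x) `^ q.
Proof.
move=> c1 x1.
have lnc0 := ln_ge0 c1; have lnx0 := ln_ge0 x1.
rewrite lnM ?posrE ?(lt_le_trans ltr01) //.
have [q0|q0] := leP 0 q.
  (* With [ln] additive on products, this case rests on [1 + u + v <= (1 + u) * (1 + v)] for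
     [u, v >= 0]. *)
  rewrite ger0_norm // -powRM ?addr_ge0 //.
  by apply: ge0_ler_powR; rewrite ?nnegrE ?mulr_ge0 ?addr_ge0 //; nra.
apply: (@le_trans _ _ ((1 + ln x) `^ q)); last first.
  by apply: ler_peMl; rewrite ?powR_ge0 // powR_ge1 ?lerDl.
rewrite -[q]opprK !(powRN _ (- q)) lef_pV2 ?posrE ?powR_gt0 //; [|lra|lra].
by apply: ge0_ler_powR; rewrite ?nnegrE; lra.
Qed.

Lemma weight_p_pq (R : realType) (p : R) : weight_p p = weight_pq p 0.
Proof. by apply/funext => t; rewrite /weight_p /weight_pq powRr0 mulr1. Qed.

Lemma weight_pq_ge0 (R : realType) (p q t : R) : 0 <= weight_pq p q t.
Proof. by rewrite mulr_ge0 ?powR_ge0. Qed.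

Lemma is_weight_ge0 (R : realType) (p q : R) (phi : R -> R) (t : R) :
  is_weight p q phi -> 0 <= phi t.
Proof. by move=> [->|[-> _]]; rewrite ?weight_p_pq weight_pq_ge0. Qed.

Lemma is_weight_nondecreasing (R : realType) (p q : R) (phi : R -> R) :
  0 < p -> is_weight p q phi ->
  forall s t, 0 <= s -> s <= t -> phi s <= phi t.
Proof.
move=> p0 [->|[_ []//]] s t s0 st.
by apply: ge0_ler_powR; rewrite ?nnegrE; lra.
Qed.

(** The argument is chosen so that [1 +] it equals [c * (1 + t)]; the power and logarithmic factors
    are then bounded separately. *)
Lemma weight_pq_dilation (R : realType) (p q c t : R) :
  0 < p -> 1 <= c -> 0 <= t ->
  weight_pq p q (c * (1 + t) - 1) <=
    c `^ p * (1 + ln c) `^ `|q| * weight_pq p q t.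
Proof.
move=> p0 c1 t0; rewrite /weight_pq addrC subrK mulrACA.
apply: ler_pM; rewrite ?powR_ge0 //.
  by rewrite powRM //; lra.
by rewrite powR_1Dln_le // lerDl.
Qed.

(* Admissibility alone only bounds [phi (n t)] by a multiple of [phi t ^ n];
   the polynomial form of the weights is what makes the bound linear. *)
Lemma is_weight_affine (R : realType) (p q : R) (phi : R -> R) (a b : R) :
  0 < p -> is_weight p q phi -> 0 <= a -> 0 <= b ->
  exists2 C : R, 1 <= C &
    forall s t, 0 <= s -> 0 <= t -> s <= a * t + b -> phi s <= C * phi t.
Proof.
move=> p0 wphi a0 b0.
have c1 : 1 <= 1 + a + b by lra.
have [q' phiE] : exists q', phi = weight_pq p q'.
  by case: wphi => [->|[-> _]]; [exists 0; rewrite weight_p_pq|exists q].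
exists ((1 + a + b) `^ p * (1 + ln (1 + a + b)) `^ `|q'|).
  have lnc0 := ln_ge0 c1.
  by apply: mulr_ege1; rewrite powR_ge1 ?lerDl // ltW.
move=> s t s0 t0 st.
(* For [t >= 0], the dilation by [1 + a + b] dominates [a * t + b], hence [s]. *)
apply: (@le_trans _ _ (phi ((1 + a + b) * (1 + t) - 1))).
  by apply: (is_weight_nondecreasing p0 wphi) => //; nra.
by rewrite phiE weight_pq_dilation.
Qed.

(** The sets [{h > r}] shrink as [r] grows, so the limit is that of a nonincreasing function. Later
    comparisons need only order arguments, even at infinite values. *)
Lemma decay_constantE (R : realType) (A : Type) (phi : R -> R) (h f : A -> R)
    (L : R) :
  decay_constant phi h f L = ereal_inf (range (tail_sup phi h f L)).
Proof.
apply/cvg_lim => //; apply: nonincreasing_cvge => r s rs.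
apply: ereal_sup_le => _ [a /= sa <-]; exists a => //=.
exact: le_lt_trans sa.
Qed.

Lemma decay_constant_le (R : realType) (A : Type) (phi : R -> R)
    (h h' f : A -> R) (L a b C : R) :
  0 < a -> 0 < C -> (forall x, h x <= a * h' x + b) ->
  (forall x, phi (h x) <= C * phi (h' x)) ->
  (decay_constant phi h f L <= C%:E * decay_constant phi h' f L)%E.
Proof.
move=> a0 C0 hh' phihh'; rewrite !decay_constantE -lee_pdivrMl //.
apply: le_ereal_inf_tmp => _ [r _ <-]; rewrite lee_pdivrMl //.
apply: (@le_trans _ _ (tail_sup phi h f L (a * r + b))).
  by apply: ereal_inf_lbound; exists (a * r + b).
apply: ge_ereal_sup => _ [x /= rx <-].
apply: (@le_trans _ _ (C%:E * (phi (h' x) * `|f x - L|)%:E)%E).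
  by rewrite -EFinM lee_fin mulrA ler_wpM2r.
rewrite lee_pmul2l ?fin_numE //; apply: ereal_sup_ubound; exists x => //=.
by have := hh' x; nra.
Qed.

Lemma bigO_at_infinity_le (R : realType) (A : Type) (p a b : R)
    (h h' f : A -> R) (L : R) :
  0 < p -> 0 < a -> 0 <= b -> (forall x, h' x <= a * h x + b) ->
  bigO_at_infinity p h f L -> bigO_at_infinity p h' f L.
Proof.
move=> p0 a0 b0 hh' [M [r HM]].
(* Beyond [a * r + b] the hypothesis at [r] applies; beyond [2 * b], [b] is less than half of
   [h' x]. The absolute value covers a negative [M]. *)
exists (`|M| * (2 * a) `^ p), (Num.max (2 * b) (a * r + b)) => x.
rewrite gt_max => /andP[bx rx]; have := hh' x => hx.
have hr : r < h x by nra.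
(* Beyond [2 b] the additive constant is absorbed by doubling the slope. *)
have h'2 : h' x <= 2 * a * h x by nra.
have hx0 : 0 < h x by nra.
have h'x0 : 0 < h' x by lra.
apply: (le_trans (HM x hr)).
apply: (@le_trans _ _ (`|M| * h x `^ (- p))).
  by rewrite ler_wpM2r ?powR_ge0 // ler_norm.
(* Both values being positive, clearing the inverses leaves the [p]-th power of
   [h' x <= 2 * a * h x]. *)
rewrite -mulrA ler_wpM2l // !powRN.
rewrite ler_pdivlMr ?powR_gt0 // ler_pdivrMl ?powR_gt0 //.
rewrite mulrC -powRM; [|lra|exact: ltW].
by apply: ge0_ler_powR; rewrite ?nnegrE //; lra.
Qed.

Lemma coarse_affine_bounds_inv (R : realType) (A : Type) (a1 a2 b1 b2 : R)
    (h h' : A -> R) (x : A) :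
  0 < a1 -> coarse_affine_bounds a1 a2 b1 b2 h h' ->
  h x <= a1^-1 * h' x + a1^-1 * b1.
Proof.
move=> a10 /(_ x)/andP[lb _]; rewrite -mulrDr mulrC ler_pdivlMr // mulrC.
by rewrite -lerBlDr.
Qed.

Theorem corollary4p27 (R : realType) (p q : R) (hp : 0 < p) :
  (forall phi : R -> R, is_weight p q phi ->
   forall a1 a2 b1 b2 : R, 0 < a1 -> 0 < a2 -> 0 <= b1 -> 0 <= b2 ->
   exists C : R, 1 <= C /\
     forall A : topologicalType,
       ~ compact [set: A] -> locally_compact [set: A] -> sigma_compact A ->
       hausdorff_space A ->
     forall h h' : A -> R,
       continuous_proper_exhaustion h -> continuous_proper_exhaustion h' ->
       coarse_affine_bounds a1 a2 b1 b2 h' h ->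
     forall (f : A -> R) (L : R), continuous f ->
       ((C^-1)%:E * decay_constant phi h f L <= decay_constant phi h' f L /\
        decay_constant phi h' f L <= C%:E * decay_constant phi h f L)%E) /\
  (forall A : topologicalType,
     ~ compact [set: A] -> locally_compact [set: A] -> sigma_compact A ->
     hausdorff_space A ->
   forall h h' : A -> R,
     continuous_proper_exhaustion h -> continuous_proper_exhaustion h' ->
     coarsely_affinely_equivalent h' h ->
   forall (f : A -> R) (L : R), continuous f ->
     bigO_at_infinity p h f L <-> bigO_at_infinity p h' f L).
Proof.
split=> [phi wphi a1 a2 b1 b2 a10 a20 b10 b20|A _ _ _ _ h h' _ _].
  have a1V0 : 0 < a1^-1 by rewrite invr_gt0.
  have b1V0 : 0 <= a1^-1 * b1 by rewrite mulr_ge0 // ltW.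
  (* One constant for each direction; both are fixed before the space and the exhaustions are
     introduced. *)
  have [C1 C11 HC1] := is_weight_affine hp wphi (ltW a20) b20.
  have [C2 C21 HC2] := is_weight_affine hp wphi (ltW a1V0) b1V0.
  pose C := Num.max C1 C2.
  have C1C : C1 <= C by rewrite le_max lexx.
  have C2C : C2 <= C by rewrite le_max lexx orbT.
  have C0 : 0 < C by lra.
  exists C; split; first by lra.
  move=> A _ _ _ _ h h' [_ h0 _] [_ h'0 _] hh' f L _.
  have up x : h x <= a2 * h' x + b2 by case/andP: (hh' x).
  have dn x : h' x <= a1^-1 * h x + a1^-1 * b1.
    exact: coarse_affine_bounds_inv hh'.
  split; first rewrite lee_pdivrMl //.
    apply: (decay_constant_le _ _ a20 C0 up) => x.
    apply: (le_trans (HC1 _ _ (h0 x) (h'0 x) (up x))).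
    by rewrite ler_wpM2r // (is_weight_ge0 _ wphi).
  apply: (decay_constant_le _ _ a1V0 C0 dn) => x.
  apply: (le_trans (HC2 _ _ (h'0 x) (h0 x) (dn x))).
  by rewrite ler_wpM2r // (is_weight_ge0 _ wphi).
move=> [a1 [a2 [b1 [b2 [a10 a20 b10 b20 hh']]]]] f L _; split.
  apply: (@bigO_at_infinity_le _ _ _ a1^-1 (a1^-1 * b1)) => //.
  - by rewrite invr_gt0.
  - by rewrite mulr_ge0 // invr_ge0 ltW.
  - by move=> x; exact: coarse_affine_bounds_inv hh'.
apply: (@bigO_at_infinity_le _ _ _ a2 b2) => // x.
by case/andP: (hh' x).
Qed.
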